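(* Let $f,g:\mathbb{R}^{N}\rightarrow (-\infty ,\infty ]$ be Borel measurable with $m_{f}:=\inf f\in \mathbb{R}$, $m_{g}:=\inf g\in \mathbb{R}$ and $m_{f}+m_{g}\geq 0$, and set $m_{f,g}:=(m_{f}-m_{g})/2$. Then $f\Box g\geq 0$, $\check{f}-m_{f,g}\geq 0$, $\check{g}+m_{f,g}\geq 0$, and $$\|(f\Box g)^{-1}\|_{\phi }\leq 2^{N-1}\left(\|(\check{f}-m_{f,g})^{-1}\|_{\phi }+\|(\check{g}+m_{f,g})^{-1}\|_{\phi }\right)$$ for every Young function $\phi$.
   Context: $(f\Box g)(x):=\inf_{y\in \mathbb{R}^{N}}(f(x-y)+g(y))$. For $h\ge0$, $h^{-1}:=1/h$ (with $1/0=\infty$, $1/\infty=0$). A Young function is a nonconstant $\phi:[0,\infty]\to[0,\infty]$ with $\phi(0)=0$, nondecreasing, convex and left continuous; the Luxemburg norm of a measurable $h$ is $\|h\|_{\phi}:=\inf\{r>0:\int_{\mathbb{R}^N}\phi(r^{-1}|h|)\le 1\}$ ($=\infty$ if no such $r$). Enclosing balls: for $X\subset\mathbb{R}^N$ nonempty and bounded, $\overline{B}_X$ is the unique closed ball of minimal diameter containing $X$; if $X$ is unbounded, $\overline{B}_X:=\mathbb{R}^N$; $\overline{B}_\emptyset:=\{0\}$. For $f:\mathbb{R}^N\to[-\infty,\infty]$ and $\xi\in[-\infty,\infty]$ let $F^-_\xi:=\{x: f(x)<\xi\}$, let $\rho^-_f(\xi)\in[0,\infty]$ be the radius of $\overline{B}_{F^-_\xi}$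 ($\infty$ if it is $\mathbb{R}^N$), let $\gamma^-_f(t):=\sup\{\xi:\rho^-_f(\xi)\le t\}$ for $t\in[0,\infty)$, and $\check f(x):=\gamma^-_f(|x|)$. (Equivalently $\check f=-\widehat{(-f)}$ where $\hat f(x)=\gamma^+_f(|x|)$, $\gamma^+_f(t)=\inf\{\xi:\rho^+_f(\xi)\le t\}$, $\rho^+_f(\xi)$ the radius of the enclosing ball of $\{f>\xi\}$.) *)

(* Defs.v *)
(* R^N is modelled as N.-tuple R with the product
   (= Borel) sigma-algebra provided by mathcomp-analysis. *)
From HB Require Import structures.
From mathcomp Require Import all_boot all_order all_algebra.
From mathcomp Require Import all_classical all_reals all_analysis.
From mathcomp Require Import measurable_realfun.
Set Implicit Arguments. Unset Strict Implicit. Unset Printing Implicit Defensive.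
Import Order.TTheory GRing.Theory Num.Theory.
Import numFieldNormedType.Exports.
Local Open Scope classical_set_scope.
Local Open Scope ring_scope.

Section defs.
Context {R : realType} {N : nat}.
Local Notation V := (N.-tuple R).

Definition vsub (x y : V) : V := [tuple tnth x i - tnth y i | i < N].
Definition enorm (x : V) : R := Num.sqrt (\sum_(i < N) tnth x i ^+ 2).
Definition cball (c : V) (r : R) : set V := [set x | enorm (vsub x c) <= r].
Definition box (a b : V) : set V := [set x | forall i, tnth a i <= tnth x i <= tnth b i].

Definition is_lebesgue (mu : {measure set V -> \bar R}) : Prop :=
  forall a b : V, (forall i, tnth a i <= tnth b i) ->
    mu (box a b) = (\prod_(i < N) (tnth b i - tnth a i))%:E.

Definition infconv (f g : V -> \bar R) (x : V) : \bar R :=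
  ereal_inf [set (f (vsub x y) + g y)%E | y in [set: V]].

(* radius of the (minimal) closed enclosing ball: +oo if unbounded, 0 if empty *)
Definition encl_radius (X : set V) : \bar R :=
  ereal_inf [set r%:E | r in [set r : R | 0 <= r /\ exists c, X `<=` cball c r]].

Definition rho_minus (f : V -> \bar R) (xi : \bar R) : \bar R :=
  encl_radius [set x | (f x < xi)%E].

Definition gamma_minus (f : V -> \bar R) (t : R) : \bar R :=
  ereal_sup [set xi : \bar R | (rho_minus f xi <= t%:E)%E].

Definition fcheck (f : V -> \bar R) (x : V) : \bar R := gamma_minus f (enorm x).

Definition luxemburg (mu : {measure set V -> \bar R}) (phi : \bar R -> \bar R)
    (h : V -> \bar R) : \bar R :=
  ereal_inf [set r%:E | r in [set r : R | 0 < r /\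
     (\int[mu]_(x in [set: V]) phi ((r^-1)%:E * `|h x|)%E <= 1)%E]].

End defs.

Definition einv {R : realType} (x : \bar R) : \bar R :=
  if x == 0%E then +oo%E else if x == +oo%E then 0%E else ((fine x)^-1)%:E.

(* Young function phi : [0,+oo] -> [0,+oo] (represented on \bar R, only
   its values on [0,+oo] matter) *)
Definition young {R : realType} (phi : \bar R -> \bar R) : Prop :=
  phi 0%E = 0%E /\
      (forall x, (0 <= x)%E -> (0 <= phi x)%E) /\
      (exists x, (0 <= x)%E /\ phi x != 0%E) /\
      (forall x y, (0 <= x)%E -> (x <= y)%E -> (phi x <= phi y)%E) /\
      (forall (a b : \bar R) (l : R), (0 <= a)%E -> (0 <= b)%E -> 0 <= l <= 1 ->
         (phi (l%:E * a + (1 - l)%:E * b) <= l%:E * phi a + (1 - l)%:E * phi b)%E)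
      (* convex *) /\
      (forall x, (0 < x)%E -> phi x = ereal_sup (phi @` [set y | (0 <= y)%E /\ (y < x)%E]))
      (* left continuous (for a nondecreasing function) *).

(* Main.v *)
Require Import Defs.
From HB Require Import structures.
From mathcomp Require Import all_boot all_order all_algebra.
From mathcomp Require Import all_classical all_reals all_analysis.
From mathcomp Require Import measurable_realfun.
From mathcomp Require Import ring lra.
Set Implicit Arguments. Unset Strict Implicit. Unset Printing Implicit Defensive.
Import Order.TTheory GRing.Theory Num.Theory numFieldNormedType.Exports.
Import HBNNSimple.
Local Open Scope classical_set_scope.
Local Open Scope ring_scope.

(** With [m = (m_f - m_g) / 2], the functions [f - m] and [g + m] are both
    bounded below by [(m_f + m_g) / 2 >= 0], so [infconv f g x < eta] forces [x]
    into the Minkowski sum of [{f - m < eta}] and [{g + m < eta}], hence into a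
    ball whose radius is the sum of their enclosing radii.  Up to left limits in
    [eta], the balls of those radii centred at the origin are the sublevel sets
    of [fcheck f - m] and [fcheck g + m], and [(p + q)^N <= 2^(N-1) (p^N + q^N)]
    compares the volumes.  Integrating this comparison of distribution functions
    (layer cake) bounds the modulars, and convexity of [phi] turns that into
    the bound on the norms.

    [infconv f g] need not be Borel, so the integral on the left is a supremum
    over simple functions below the integrand, and the comparison is made for
    each such simple function. *)

(** * The Euclidean norm and the volume of balls *)

Lemma enorm_ge0 (R : realType) (N : nat) (x : N.-tuple R) : 0 <= enorm x.
Proof. exact: sqrtr_ge0. Qed.

Lemma enorm_sqr (R : realType) (N : nat) (x : N.-tuple R) :
  enorm x ^+ 2 = \sum_(i < N) tnth x i ^+ 2.
Proof. by apply/sqr_sqrtr/sumr_ge0 => i _; exact: sqr_ge0. Qed.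

(** Cauchy-Schwarz. With [a], [b] the two norms, the nonnegative sum of the squares of
    [b * x_i - a * y_i] expands to [2 a b (a b - <x, y>)]; cancelling [2 a b] needs both norms
    positive, so zero norms are treated first. *)
Lemma sum_mul_le_enorm (R : realType) (N : nat) (x y : N.-tuple R) :
  \sum_(i < N) tnth x i * tnth y i <= enorm x * enorm y.
Proof.
have vanish (z w : N.-tuple R) : enorm z = 0 -> \sum_(i < N) tnth z i * tnth w i = 0.
  move=> z0; have /eqP := enorm_sqr z; rewrite z0 expr0n/= eq_sym psumr_eq0.
    move=> /allP z2; apply: big1 => i _.
    by have := z2 i (mem_index_enum _); rewrite sqrf_eq0 => /eqP ->; rewrite mul0r.
  by move=> i _; exact: sqr_ge0.
have [x0|x0] := eqVneq (enorm x) 0; first by rewrite vanish// x0 mul0r.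
have [y0|y0] := eqVneq (enorm y) 0.
  under eq_bigr do rewrite mulrC.
  by rewrite vanish// y0 mulr0.
have {}x0 : 0 < enorm x by rewrite lt_neqAle eq_sym x0 enorm_ge0.
have {}y0 : 0 < enorm y by rewrite lt_neqAle eq_sym y0 enorm_ge0.
set a := enorm x in x0 *; set b := enorm y in y0 *.
have key : 0 <= \sum_(i < N) (b * tnth x i - a * tnth y i) ^+ 2.
  by apply: sumr_ge0 => i _; exact: sqr_ge0.
suff E : \sum_(i < N) (b * tnth x i - a * tnth y i) ^+ 2 =
    2 * (a * b) * (a * b - \sum_(i < N) tnth x i * tnth y i).
  by move: key; rewrite E pmulr_rge0 ?subr_ge0// !mulr_gt0.
transitivity (b ^+ 2 * (\sum_(i < N) tnth x i ^+ 2) +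
    a ^+ 2 * (\sum_(i < N) tnth y i ^+ 2) -
    2 * (a * b) * \sum_(i < N) tnth x i * tnth y i); last first.
  by rewrite -!enorm_sqr -/a -/b; ring.
rewrite !mulr_sumr -big_split -sumrB; apply: eq_bigr => i _ /=; ring.
Qed.

Lemma enorm_triangle (R : realType) (N : nat) (x y z : N.-tuple R) :
  (forall i, tnth z i = tnth x i + tnth y i) -> enorm z <= enorm x + enorm y.
Proof.
move=> zE; rewrite -(ler_pXn2r (n := 2))// ?nnegrE ?addr_ge0 ?enorm_ge0//.
rewrite sqrrD !enorm_sqr.
have -> : \sum_(i < N) tnth z i ^+ 2 = \sum_(i < N) tnth x i ^+ 2 +
   (\sum_(i < N) tnth x i * tnth y i) *+ 2 + \sum_(i < N) tnth y i ^+ 2.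
  rewrite -sumrMnl -!big_split; apply: eq_bigr => i _ /=; rewrite zE; ring.
by rewrite lerD2r lerD2l lerMn2r/= sum_mul_le_enorm.
Qed.

Lemma enorm_scale (R : realType) (N : nat) (r : R) (x z : N.-tuple R) : 0 <= r ->
  (forall i, tnth z i = r * tnth x i) -> enorm z = r * enorm x.
Proof.
move=> r0 zE; rewrite /enorm; under eq_bigr do rewrite zE exprMn.
by rewrite -mulr_sumr sqrtrM ?sqr_ge0// sqrtr_sqr ger0_norm.
Qed.

Lemma tnth_le_enorm (R : realType) (N : nat) (x : N.-tuple R) i :
  `|tnth x i| <= enorm x.
Proof.
rewrite -sqrtr_sqr ler_wsqrtr// (bigD1 i)//= lerDl.
by apply: sumr_ge0 => j _; exact: sqr_ge0.
Qed.

Lemma measurable_enorm (R : realType) (N : nat) :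
  measurable_fun [set: N.-tuple R] (@enorm R N).
Proof.
apply: (measurableT_comp (f := @Num.sqrt R)).
  by apply: continuous_measurable_fun; exact: sqrt_continuous.
apply: measurable_sum => i; apply: measurable_funX; exact: measurable_tnth.
Qed.

Definition affmap (R : realType) (N : nat) (c : N.-tuple R) (r : R) (x : N.-tuple R) :
  N.-tuple R := [tuple tnth c i + r * tnth x i | i < N].

Lemma measurable_affmap (R : realType) (N : nat) (c : N.-tuple R) (r : R) :
  measurable_fun [set: N.-tuple R] (affmap c r).
Proof.
apply/measurable_fun_tnthP => i.
rewrite (_ : _ \o _ = fun x => tnth c i + r * tnth x i); last first.
  by apply/funext => x /=; rewrite tnth_mktuple.
apply: measurable_funD => //; apply: measurable_funM => //; exact: measurable_tnth.
Qed.

Lemma measurable_cball (R : realType) (N : nat) (c : N.-tuple R) (r : R) :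
  measurable (cball c r).
Proof.
have mf : measurable_fun [set: N.-tuple R] (fun x => enorm (vsub x c)).
  apply: measurableT_comp; first exact: measurable_enorm.
  apply/measurable_fun_tnthP => i.
  rewrite (_ : _ \o _ = fun x => tnth x i - tnth c i); last first.
    by apply/funext => x /=; rewrite tnth_mktuple.
  by apply: measurable_funB => //; exact: measurable_tnth.
have := mf measurableT _ (measurable_itv `]-oo, r]); rewrite setTI.
by congr measurable; apply/seteqP; split => x /=; rewrite in_itv/=.
Qed.

Lemma measurable_box (R : realType) (N : nat) (a b : N.-tuple R) :
  measurable (box a b).
Proof.
have -> : box a b =
    \bigcap_(i in [set: 'I_N]) ((@tnth N R)^~ i @^-1` `[tnth a i, tnth b i]).
  apply/seteqP; split => [x abx i _|x abx i]; first by rewrite /= in_itv /=; exact: abx.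
  by have := abx i I; rewrite /= in_itv.
apply: fin_bigcap_measurable => // i _.
by rewrite -[X in measurable X]setTI; exact: measurable_tnth.
Qed.

Lemma cball_sub_box (R : realType) (N : nat) (c : N.-tuple R) (r : R) :
  cball c r `<=` box [tuple tnth c i - r | i < N] [tuple tnth c i + r | i < N].
Proof.
move=> x /= xr i; rewrite !tnth_mktuple -ler_distl.
by have := tnth_le_enorm (vsub x c) i; rewrite tnth_mktuple => /le_trans -> .
Qed.

Lemma bigcup_box_nat (R : realType) (N : nat) :
  \bigcup_n box [tuple - n%:R | i < N] [tuple n%:R | i < N] = [set: N.-tuple R].
Proof.
rewrite -subTset => x _; exists (Num.truncn (enorm x)).+1 => // j.
rewrite !tnth_mktuple -ler_norml.
by rewrite (le_trans (tnth_le_enorm x j))// ltW// truncnS_gt.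
Qed.

(** [is_lebesgue] prescribes [mu] on boxes only, so uniqueness arguments need boxes to generate the
    sigma-algebra. They do because each half-space [r <= x_i] is a countable union of boxes. *)
Lemma measurable_tuple_boxE (R : realType) (N : nat) :
  @measurable _ (N.-tuple R) =
    <<s [set box a b | a in [set: N.-tuple R] & b in [set: N.-tuple R]] >>.
Proof.
set G := [set _ | _ in _ & _ in _].
apply/seteqP; split; last first.
  apply: smallest_sub; first exact: sigma_algebra_measurable.
  by move=> _ [a _ [b _ <-]]; exact: measurable_box.
apply: smallest_sub; first exact: smallest_sigma_algebra.
rewrite -bigcup_seq => A [i _ [B mB <-]].
have sub : @measurable _ R `<=` image_set_system setT ((@tnth N R)^~ i) <<s G >>.
  have -> : @measurable _ R = <<s @RGenCInfty.G R >> by exact: RGenCInfty.measurableE.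
  apply: smallest_sub; first exact/sigma_algebra_image/smallest_sigma_algebra.
  move=> _ [r ->]; rewrite /image_set_system/= setTI.
  have -> : (@tnth N R)^~ i @^-1` `[r, +oo[ = \bigcup_n
      box [tuple if j == i then r else - n%:R | j < N] [tuple n%:R | j < N].
    apply/seteqP; split => [x /=|x [n _ /(_ i)]]; last first.
      by rewrite !tnth_mktuple eqxx /= in_itv/= andbT => /andP[].
    rewrite in_itv/= andbT => rx; exists (Num.truncn (enorm x)).+1 => // j.
    rewrite !tnth_mktuple.
    have : `|tnth x j| <= (Num.truncn (enorm x)).+1%:R.
      by rewrite (le_trans (tnth_le_enorm x j))// ltW// truncnS_gt.
    by rewrite ler_norml => /andP[xj ->]; rewrite andbT; case: eqP => // ->.
  apply: sigma_algebra_bigcup => n; apply: sub_sigma_algebra.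
  exists [tuple if j == i then r else - n%:R | j < N] => //.
  by exists [tuple n%:R | j < N].
exact: sub.
Qed.

(** * Scaling of Lebesgue measure and the volume of balls *)

Section lebesgue.
Variables (R : realType) (N : nat) (mu : {measure set (N.-tuple R) -> \bar R}).
Hypothesis hmu : is_lebesgue mu.

Lemma is_lebesgue_box_lty (a b : N.-tuple R) : (mu (box a b) < +oo)%E.
Proof.
have [ab|/existsNP[i /negP ab]] := pselect (forall i, tnth a i <= tnth b i).
  by rewrite hmu// ltry.
rewrite (_ : box a b = set0) ?measure0//.
apply/seteqP; split => // x /(_ i) /andP[ax xb].
by move: ab; rewrite (le_trans ax xb).
Qed.

Lemma is_lebesgue_sigma_finite : sigma_finite setT mu.
Proof.
exists (fun n => box [tuple - n%:R | i < N] [tuple n%:R | i < N]); last first.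
  by move=> n; split; [exact: measurable_box|exact: is_lebesgue_box_lty].
exact/esym/bigcup_box_nat.
Qed.

(** Both sides are measures in [A] that agree on boxes, a generating family closed under
    intersection and containing an exhaustion of the space by sets of finite measure; hence they
    coincide. *)
Lemma is_lebesgue_affmap (c : N.-tuple R) (r : R) (A : set (N.-tuple R)) :
  0 < r -> measurable A -> mu A = ((r ^+ N)%:E * mu (affmap c r @^-1` A))%E.
Proof.
move=> r0 mA.
pose rN : {nonneg R} := NngNum (exprn_ge0 N (ltW r0)).
have [nu nuE] : exists nu : {measure set (N.-tuple R) -> \bar R},
    forall B, nu B = ((r ^+ N)%:E * mu (affmap c r @^-1` B))%E.
  unshelve eexists (mscale rN (pushforward mu (affmap c r))) => //.
  exact: measurable_affmap.
rewrite -nuE.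
apply: (measure_unique _ (fun n => box [tuple - n%:R | i < N] [tuple n%:R | i < N])
  (measurable_tuple_boxE R N)) => //.
- move=> _ _ [a _ [b _ <-]] [a' _ [b' _ <-]].
  exists [tuple Num.max (tnth a i) (tnth a' i) | i < N] => //.
  exists [tuple Num.min (tnth b i) (tnth b' i) | i < N] => //.
  apply/seteqP; split => [x abx|x [abx abx'] i].
    split => i; have := abx i; rewrite !tnth_mktuple ge_max le_min;
      by move=> /andP[/andP[? ?] /andP[? ?]]; apply/andP.
  have /andP[ax xb] := abx i; have /andP[ax' xb'] := abx' i.
  by rewrite !tnth_mktuple ge_max le_min ax ax' xb xb'.
- by move=> n; exists [tuple - n%:R | i < N] => //; exists [tuple n%:R | i < N].
- exact: bigcup_box_nat.
- move=> _ [a _ [b _ <-]].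
  rewrite nuE.
  have -> : affmap c r @^-1` box a b =
     box [tuple (tnth a i - tnth c i) / r | i < N] [tuple (tnth b i - tnth c i) / r | i < N].
    apply/seteqP; split => x /= abx i; have := abx i;
    by rewrite !tnth_mktuple ler_pdivrMr// ler_pdivlMr// lerBlDl lerBrDl [r * _]mulrC.
  (* The generating family also contains boxes with a reversed side, which arise as intersections of
     disjoint boxes; these are empty and both measures vanish on them. *)
  have [ab|/existsNP[i /negP ab]] := pselect (forall i, tnth a i <= tnth b i).
    rewrite !hmu//; last first.
      by move=> i; rewrite !tnth_mktuple ler_pM2r ?invr_gt0// lerD2r.
    rewrite -EFinM -[N in r ^+ N]card_ord -prodr_const -big_split/=; congr EFin.
    apply: eq_bigr => i _; rewrite !tnth_mktuple; field; exact: lt0r_neq0.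
  have box0 (a' b' : N.-tuple R) : ~~ (tnth a' i <= tnth b' i) -> box a' b' = set0.
    move=> ab'; apply/seteqP; split => // x /(_ i) /andP[ax xb].
    by move: ab'; rewrite (le_trans ax xb).
  rewrite !box0// ?measure0 ?mule0//.
  by rewrite !tnth_mktuple ler_pM2r ?invr_gt0// lerD2r.
- by move=> n; exact: is_lebesgue_box_lty.
Qed.

(** Taking [fine] loses nothing: the unit ball lies in a box of finite measure. *)
Definition ballvol : R := fine (mu (cball [tuple 0 | i < N] 1)).

Lemma ballvol_ge0 : 0 <= ballvol.
Proof. exact/fine_ge0. Qed.

Lemma is_lebesgue_cball (c : N.-tuple R) (r : R) : 0 < r ->
  mu (cball c r) = (ballvol * r ^+ N)%:E.
Proof.
move=> r0; rewrite (is_lebesgue_affmap c r0); last exact: measurable_cball.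
have -> : affmap c r @^-1` cball c r = cball [tuple 0 | i < N] 1.
  have enormE x : enorm (vsub (affmap c r x) c) = r * enorm (vsub x [tuple 0 | i < N]).
    apply: enorm_scale; first exact: ltW.
    by move=> i; rewrite !tnth_mktuple subr0 addrAC subrr add0r.
  by apply/seteqP; split=> x; rewrite /cball /preimage /mkset enormE -{2}[r]mulr1 ler_pM2l.
rewrite mulrC EFinM fineK// ge0_fin_numE//.
exact: le_lt_trans (le_measure mu (mem_set (measurable_cball _ _))
  (mem_set (measurable_box _ _)) (@cball_sub_box _ _ _ _)) (is_lebesgue_box_lty _ _).
Qed.
End lebesgue.

(** * Layer cake formula *)

Section layer_cake.
Local Open Scope ereal_scope.
Context d (T : measurableType d) (R : realType).
Variable mu : {measure set T -> \bar R}.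
Hypothesis mu_sigma_finite : sigma_finite setT mu.

(** A named copy of [mu] that carries the sigma-finite structure required by Tonelli's theorem. *)
Let nu : set T -> \bar R := mu.
HB.instance Definition _ := Measure.on nu.
HB.instance Definition _ := @Measure_isSigmaFinite.Build _ _ _ nu mu_sigma_finite.

Definition hypograph (u : T -> \bar R) : set (T * R) :=
  [set p | (0 <= p.2)%R /\ p.2%:E < u p.1].

Lemma measurable_hypograph (u : T -> \bar R) :
  measurable_fun setT u -> measurable (hypograph u).
Proof.
move=> mu_; have -> : hypograph u =
    (setT `*` `[0%R, +oo[) `&` (setT `&` [set p | p.2%:E < u p.1]).
  apply/seteqP; split => [[x t]/= [t0 tu]|[x t]/= [[_ t0] [_ tu]]].
    by rewrite in_itv/= andbT.
  by move: t0; rewrite in_itv/= andbT.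
apply: measurableI; first exact: measurableX.
apply: measurable_lte => //.
  by apply: (measurableT_comp (f := EFin)).
by apply: measurableT_comp.
Qed.

(** Tonelli for the indicator of the hypograph: the section over [x] is the interval from 0 to
    [u x], of length [u x], and the section at a height [t >= 0] is the superlevel set of [u]. *)
Lemma layer_cake (u : T -> \bar R) : measurable_fun setT u -> (forall x, 0 <= u x) ->
  \int[mu]_x u x = \int[lebesgue_measure]_t mu (ysection (hypograph u) t).
Proof.
move=> mu_ u0.
have := indic_fubini_tonelli nu lebesgue_measure (measurable_hypograph mu_).
rewrite indic_fubini_tonelli_FE ?indic_fubini_tonelli_GE; try exact: measurable_hypograph.
apply: etrans; apply: eq_integral => x _ /=.
have := u0 x; case E: (u x) => [r| |] // r0.
- rewrite (_ : xsection _ _ = `[0%R, r[%classic); last first.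
    apply/seteqP; split => t; rewrite /xsection /hypograph /= inE/= E lte_fin in_itv/=.
      by move=> [-> ->].
    by move=> /andP[].
  rewrite lebesgue_measure_itv/= lte_fin; case: ltP => [_|]; first by rewrite EFinN sube0.
  by rewrite -lee_fin => rn; congr EFin; apply/eqP; rewrite eq_le -!lee_fin r0 rn.
- rewrite (_ : xsection _ _ = `[0%R, +oo[%classic); last first.
    apply/seteqP; split => t; rewrite /xsection /hypograph /= inE/= E ltry in_itv/= andbT //.
    by case.
  by rewrite lebesgue_measure_itv/= ltry.
Qed.

Lemma le_integral_tails (s u v : T -> \bar R) (C : R) :
  measurable_fun setT s -> measurable_fun setT u -> measurable_fun setT v ->
  (forall x, 0 <= s x) -> (forall x, 0 <= u x) -> (forall x, 0 <= v x) -> (0 <= C)%R ->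
  (forall t : R, (0 <= t)%R -> mu [set x | t%:E < s x] <=
    C%:E * (mu [set x | t%:E < u x] + mu [set x | t%:E < v x])) ->
  \int[mu]_x s x <= C%:E * (\int[mu]_x u x + \int[mu]_x v x).
Proof.
move=> ms mu_ mv s0 u0 v0 C0 tails; rewrite !layer_cake//.
have mF (w : T -> \bar R) : measurable_fun setT w ->
    measurable_fun [set: R] (fun t => mu (ysection (hypograph w) t)).
  by move=> mw; apply: (measurable_fun_ysection nu); exact: measurable_hypograph.
rewrite -ge0_integralD//; [|exact: mF|exact: mF].
rewrite -ge0_integralZl//; last 2 first.
- by apply: emeasurable_funD; apply: mF.
- by move=> t _; rewrite adde_ge0.
apply: ge0_le_integral => //; first exact: mF.
- by apply: measurable_funeM; apply: emeasurable_funD; apply: mF.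
move=> t _; have [t0|t0] := leP 0%R t.
  have E (w : T -> \bar R) : ysection (hypograph w) t = [set x | t%:E < w x].
    by apply/seteqP; split => x; rewrite /ysection /hypograph/= inE/= => // -[].
  by rewrite !E; exact: tails.
(* The hypograph keeps only nonnegative heights, so negative [t] contribute nothing on the left. *)
rewrite (_ : ysection (hypograph s) t = set0) ?measure0 ?mule_ge0 ?adde_ge0//.
apply/seteqP; split => // x; rewrite /ysection /hypograph/= inE/= => -[+ _].
by rewrite leNgt t0.
Qed.
End layer_cake.

(** * Enclosing radii and radial rearrangements *)

(** The source of the factor [2 ^ (N - 1)]. In the induction step the deficit is
    [(p - q) * (p ^ n.+1 - q ^ n.+1)], whose two factors have the same sign. *)
Lemma exprD_le_pow2 (R : realFieldType) (n : nat) (p q : R) : 0 <= p -> 0 <= q ->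
  (p + q) ^+ n.+1 <= 2 ^+ n * (p ^+ n.+1 + q ^+ n.+1).
Proof.
move=> p0 q0; elim: n => [|n IH]; first by rewrite !expr1 expr0 mul1r.
rewrite exprS; apply: le_trans (ler_wpM2l (addr_ge0 p0 q0) IH) _.
have cross : 0 <= (p - q) * (p ^+ n.+1 - q ^+ n.+1).
  have [pq|qp] := leP p q.
    by rewrite mulr_le0// subr_le0// lerXn2r.
  by rewrite mulr_ge0// subr_ge0 ?lerXn2r// ltW.
rewrite mulrCA [2 ^+ n.+1]exprSr -mulrA ler_wpM2l ?exprn_ge0//.
rewrite -subr_ge0 (exprS p n.+1) (exprS q n.+1).
suff -> : 2 * (p * p ^+ n.+1 + q * q ^+ n.+1) - (p + q) * (p ^+ n.+1 + q ^+ n.+1) =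
  (p - q) * (p ^+ n.+1 - q ^+ n.+1) by [].
by ring.
Qed.

Lemma continuous_scale_expr (R : realType) (w : R) (n : nat) :
  continuous (fun r : R => w * r ^+ n).
Proof. by move=> p; apply: cvgMl_tmp; exact: exprn_continuous. Qed.

Lemma scale_expr_le_left (R : realType) (w p : R) (n : nat) (M : \bar R) : 0 < p ->
  (forall r, 0 < r -> r < p -> ((w * r ^+ n)%:E <= M)%E) -> ((w * p ^+ n)%:E <= M)%E.
Proof.
move=> p0; case: M => [M| |] H; last 2 first.
- by rewrite leey.
- have p2 : p / 2 < p by rewrite ltr_pdivrMr// ltr_pMr// ltr1n.
  by have := H _ (divr_gt0 p0 (ltr0Sn _ 1)) p2.
rewrite lee_fin; apply: (@cvgr_to_le _ (p^'-) _ _ (fun r : R => w * r ^+ n)).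
  by apply: cvg_at_left_filter; exact: continuous_scale_expr.
by near=> r; rewrite -lee_fin; apply: H; near: r; [exact: nbhs_left_gt|exact: nbhs_left_lt].
Unshelve. all: by end_near. Qed.

Lemma scale_expr_ge_right (R : realType) (w p : R) (n : nat) (M : \bar R) :
  (forall r, p < r -> (M <= (w * r ^+ n)%:E)%E) -> (M <= (w * p ^+ n)%:E)%E.
Proof.
case: M => [M| |] H; last 2 first.
- by have /H : p < p + 1 by rewrite ltrDl.
- by rewrite leNye.
rewrite lee_fin; apply: (@cvgr_to_ge _ (p^'+) _ _ (fun r : R => w * r ^+ n)).
  by apply: cvg_at_right_filter; exact: continuous_scale_expr.
by near=> r; rewrite -lee_fin; apply: H; near: r; exact: nbhs_right_gt.
Unshelve. all: by end_near. Qed.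

(** A Fatou-type bound for sets that need not be nested: the points of [A] lying in every [B k] with
    [k >= n] form an increasing sequence of subsets of [B n] with union [A], and [mu] is continuous
    from below. *)
Lemma measure_eventually_le d (T : measurableType d) (R : realType)
  (mu : {measure set T -> \bar R}) (A : set T) (B : nat -> set T) (M : \bar R) :
  measurable A -> (forall n, measurable (B n)) -> (forall n, (mu (B n) <= M)%E) ->
  (forall x, A x -> exists n, forall k, (n <= k)%N -> B k x) -> (mu A <= M)%E.
Proof.
move=> mA mB BM AB.
pose E n := A `&` \bigcap_(k in [set k | (n <= k)%N]) B k.
have mE n : measurable (E n).
  by apply: measurableI => //; apply: bigcap_measurable => //; exists n => /=.
have AE : A = \bigcup_n E n.
  apply/seteqP; split => [x Ax|x [n _ []]//].
  by have [n Bn] := AB x Ax; exists n => //; split => // k /=; exact: Bn.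
have mUE : measurable (\bigcup_n E n) by rewrite -AE.
have ndE : nondecreasing_seq E.
  move=> m n mn; apply/subsetPset => x [Ax Bx]; split => // k /= nk; apply: Bx => /=.
  exact: leq_trans nk.
have cvgE := nondecreasing_cvg_mu (mu := mu) mE mUE ndE.
rewrite AE -(cvg_lim _ cvgE)//; apply: lime_le; first by apply/cvg_ex; eexists; exact: cvgE.
apply: nearW => n /=; apply: le_trans (BM n); apply: le_measure; rewrite ?inE//.
by move=> x [_ /(_ n)]; apply => /=.
Qed.

(** Replaces a possibly infinite level by real levels increasing to it, to which the shifts by [m]
    apply. *)
Lemma ereal_increasing_approx (R : realType) (xi : \bar R) : (-oo < xi)%E ->
  exists eta : nat -> R, [/\ (forall n, ((eta n)%:E < xi)%E),
    {homo eta : m n / (m <= n)%N >-> m <= n} &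
    forall z, (z < xi)%E -> exists n, (z < (eta n)%:E)%E].
Proof.
case: xi => [r| |] // _.
  exists (fun n => r - n.+1%:R^-1); split.
  - by move=> n; rewrite lte_fin ltrBlDr ltrDl invr_gt0.
  - by move=> m n mn; rewrite lerB// lef_pV2 ?posrE// ler_nat ltnS.
  - case=> [z| |] //; last by exists 0%N; rewrite ltNyr.
    rewrite lte_fin => zr; exists (Num.truncn (r - z)^-1).
    rewrite lte_fin ltrBrDl -ltrBrDr.
    rewrite invf_plt ?posrE ?subr_gt0//; exact: truncnS_gt.
exists (fun n => n%:R); split.
- by move=> n; rewrite ltry.
- by move=> m n mn; rewrite ler_nat.
- case=> [z| |] //; last by exists 0%N; rewrite ltNyr.
  by exists (Num.truncn z).+1; rewrite lte_fin truncnS_gt.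
Qed.

Section rearrangement.
Variables (R : realType) (N : nat).
Implicit Types (f g : N.-tuple R -> \bar R) (x y c : N.-tuple R).

Lemma subset_cball c (r r' : R) : r <= r' -> cball c r `<=` cball c r'.
Proof. by move=> rr' x /le_trans; exact. Qed.

Lemma rho_minus_ge0 f xi : (0 <= rho_minus f xi)%E.
Proof. by apply: le_ereal_inf_tmp => _ [r [r0 _] <-]; rewrite lee_fin. Qed.

Lemma rho_minus_homo f (xi xi' : \bar R) : (xi <= xi')%E ->
  (rho_minus f xi <= rho_minus f xi')%E.
Proof.
move=> xixi'; apply: ereal_inf_le_tmp => _ [r [r0 [c fc]] <-].
exists r => //; split => //; exists c => x /= fx; apply: fc => /=.
exact: lt_le_trans xixi'.
Qed.

Lemma rho_minus_lt_cball f xi (r : R) : (rho_minus f xi < r%:E)%E ->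
  exists c, [set x | (f x < xi)%E] `<=` cball c r.
Proof.
move=> /ereal_inf_lt[_ [r' [r'0 [c fc]] <-]]; rewrite lte_fin => r'r.
by exists c; apply: subset_trans fc _; exact/subset_cball/ltW.
Qed.

(** A level above [xi] entering the supremum would have enclosing radius at most [enorm x], and by
    monotonicity so would [xi]. *)
Lemma fcheck_le f xi x : ((enorm x)%:E < rho_minus f xi)%E -> (fcheck f x <= xi)%E.
Proof.
move=> xrho; apply: ge_ereal_sup => eta /= etax; rewrite leNgt; apply/negP => xieta.
have := lt_le_trans xrho (le_trans (rho_minus_homo f (ltW xieta)) etax).
by rewrite ltxx.
Qed.

Lemma fcheck_homo f x y : enorm x <= enorm y -> (fcheck f x <= fcheck f y)%E.
Proof.
by move=> xy; apply: ereal_sup_le => xi /= /le_trans; apply; rewrite lee_fin.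
Qed.

(** Nothing lies strictly below the infimum, so that sublevel set is empty, has radius 0, and the
    infimum enters the supremum at every [x]. *)
Lemma fcheck_ge_inf f x : (ereal_inf (range f) <= fcheck f x)%E.
Proof.
apply: ereal_sup_ubound => /=.
suff -> : rho_minus f (ereal_inf (range f)) = 0%E by rewrite lee_fin enorm_ge0.
apply/eqP; rewrite eq_le rho_minus_ge0 andbT.
apply: ereal_inf_lbound; exists 0 => //; split => //; exists [tuple 0 | i < N] => y /=.
by rewrite ltNge => /negP[]; apply: ereal_inf_lbound; exists y.
Qed.

(** Some [y] has [f (x - y) + g y < eta]. As [g y >= m_g], [f (x - y) < eta - m_g], which is at most
    [eta + (m_f - m_g) / 2] because [m_f + m_g >= 0]; symmetrically for [g y]. The triangle
    inequality adds the radii. *)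
Lemma infconv_lt_cball f g (m_f m_g eta : R) (c c' : N.-tuple R) (r r' : R) :
  ereal_inf (range f) = m_f%:E -> ereal_inf (range g) = m_g%:E -> 0 <= m_f + m_g ->
  [set x | (f x < (eta + (m_f - m_g) / 2)%:E)%E] `<=` cball c r ->
  [set x | (g x < (eta - (m_f - m_g) / 2)%:E)%E] `<=` cball c' r' ->
  [set x | (infconv f g x < eta%:E)%E] `<=`
    cball [tuple tnth c i + tnth c' i | i < N] (r + r').
Proof.
move=> hf hg hm fc gc x /= /ereal_inf_lt[_ [y _ <-]] fgy.
have fy : (m_f%:E <= f (vsub x y))%E.
  by rewrite -hf; apply: ereal_inf_lbound; exists (vsub x y).
have gy : (m_g%:E <= g y)%E by rewrite -hg; apply: ereal_inf_lbound; exists y.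
have [xyc yc] : cball c r (vsub x y) /\ cball c' r' y.
  move: fgy fy gy (fc (vsub x y)) (gc y) => /=.
  case: (f _) => [a| |] //; case: (g y) => [b| |] //.
  rewrite -EFinD !lte_fin !lee_fin => ab ma mb fc0 gc0; split; [apply: fc0|apply: gc0]; lra.
apply: le_trans (lerD xyc yc).
by apply: enorm_triangle => i; rewrite !tnth_mktuple; ring.
Qed.
End rearrangement.

(** Such a set is the preimage under the norm of a downward closed subset of the line, which is an
    interval. *)
Lemma measurable_radial (R : realType) (N : nat) (S : set (N.-tuple R)) :
  (forall x y, enorm y <= enorm x -> S x -> S y) -> measurable S.
Proof.
move=> radS; pose J := [set t : R | exists2 x, S x & t <= enorm x].
have -> : S = setT `&` @enorm R N @^-1` J.
  apply/seteqP; split => [x Sx|x [_ [y Sy xy]]]; last exact: radS Sy.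
  by split => //; exists x.
apply: measurable_enorm => //; apply: is_interval_measurable => s t _ [x Sx tx] u /andP[_ ut].
by exists x => //; exact: le_trans tx.
Qed.

Lemma measurable_fun_radial (R : realType) (N : nat) (u : N.-tuple R -> \bar R) :
  (forall x y, enorm y <= enorm x -> (u x <= u y)%E) -> measurable_fun setT u.
Proof.
move=> radu; apply: (measurability _ (ErealGenOInfty.measurableE R)).
move=> _ [_ [a ->] <-]; rewrite setTI; apply: measurable_radial => x y yx /=.
rewrite !in_itv/= !andbT => /lt_le_trans; apply; exact: radu.
Qed.

(** * Comparison of distribution functions *)

Section distribution.
Variables (R : realType) (N : nat) (mu : {measure set (N.-tuple R) -> \bar R}).
Hypotheses (hN : (0 < N)%N) (hmu : is_lebesgue mu).
Implicit Types (f g : N.-tuple R -> \bar R).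

(** [p] is the left limit at [xi] of the enclosing radius. Any [r < p] is exceeded by the radius at
    some [eta < xi], so [fcheck f - k <= eta] on the ball of radius [r]; then [r] tends to [p]. *)
Lemma measure_rho_minus_le f (k : R) (xi : \bar R) (p : R) :
  ereal_sup [set rho_minus f (eta + k)%:E | eta in [set eta | (eta%:E < xi)%E]] = p%:E ->
  0 <= p -> ((ballvol mu * p ^+ N)%:E <= mu [set x | (fcheck f x - k%:E < xi)%E])%E.
Proof.
move=> pE; rewrite le_eqVlt => /predU1P[<-|p0].
  by rewrite expr0n (gtn_eqF hN) mulr0.
apply: scale_expr_le_left => // r r0 rp.
have /ereal_sup_gt[_ [eta etaxi <-] rrho] : (r%:E < ereal_sup [set rho_minus f (eta + k)%:E |
  eta in [set eta | (eta%:E < xi)%E]])%E by rewrite pE lte_fin.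
rewrite -(is_lebesgue_cball hmu [tuple 0 | i < N] r0).
apply: le_measure; rewrite ?inE.
- exact: measurable_cball.
- apply: measurable_radial => y z /= yz; apply: le_lt_trans.
  by rewrite leeD2r// fcheck_homo.
- move=> x /= xr; apply: le_lt_trans etaxi.
  rewrite EFinN leeBlDr// -EFinD; apply: fcheck_le.
  apply: le_lt_trans rrho; rewrite lee_fin.
  suff -> : enorm x = enorm (vsub x [tuple 0 | i < N]) by [].
  by rewrite /enorm; congr Num.sqrt; apply: eq_bigr => i _; rewrite !tnth_mktuple subr0.
Qed.

Lemma fcheck_lt_setT f (k : R) (xi : \bar R) :
  ereal_sup [set rho_minus f (eta + k)%:E | eta in [set eta | (eta%:E < xi)%E]] = +oo%E ->
  [set x | (fcheck f x - k%:E < xi)%E] = setT.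
Proof.
move=> supy; rewrite -subTset => x _ /=.
have /ereal_sup_gt[_ [eta etaxi <-] xrho] : ((enorm x)%:E < ereal_sup
  [set rho_minus f (eta + k)%:E | eta in [set eta | (eta%:E < xi)%E]])%E by rewrite supy ltry.
by apply: le_lt_trans etaxi; rewrite EFinN leeBlDr// -EFinD; exact: fcheck_le.
Qed.

(** The volume of a ball of radius [p + q], with [p] and [q] the left limits of the two enclosing
    radii, separates the two sides: it bounds [mu A] from above, and [exprD_le_pow2] splits it into
    the volumes for [p] and [q]. *)
Lemma measure_infconv_lt_le f g (m_f m_g m : R) (xi : \bar R) (A : set (N.-tuple R)) :
  ereal_inf (range f) = m_f%:E -> ereal_inf (range g) = m_g%:E -> 0 <= m_f + m_g ->
  (-oo < xi)%E -> measurable A -> A `<=` [set x | (infconv f g x < xi)%E] ->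
  m = (m_f - m_g) / 2 ->
  (mu A <= (2 ^+ N.-1)%:E * (mu [set x | (fcheck f x - m%:E < xi)%E] +
                             mu [set x | (fcheck g x + m%:E < xi)%E]))%E.
Proof.
move=> hf hg hm xiNy mA Axi mE.
have [eta [etaxi eta_nd etaP]] := ereal_increasing_approx xiNy.
have -> : [set x | (fcheck g x + m%:E < xi)%E] = [set x | (fcheck g x - (- m)%:E < xi)%E].
  by rewrite EFinN oppeK.
pose D f k := [set x | (fcheck f x - k%:E < xi)%E].
pose P f k := ereal_sup [set rho_minus f (eta + k)%:E | eta in [set eta | (eta%:E < xi)%E]].
rewrite -/(D f m) -/(D g (- m)).
have P0 h k : (0 <= P h k)%E.
  apply: le_ereal_sup_tmp; exists (rho_minus h (eta 0%N + k)%:E) => //; last exact: rho_minus_ge0.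
  by exists (eta 0%N) => //=; exact: etaxi.
have C1 : (1 <= (2 ^+ N.-1 : R)%:E)%E by rewrite lee_fin exprn_ege1// ler1n.
have full : (mu A <= mu setT)%E by apply: le_measure; rewrite ?inE.
have total (a : \bar R) (b : \bar R) : (mu A <= a)%E -> (0 <= b)%E ->
    (mu A <= (2 ^+ N.-1)%:E * (a + b))%E.
  move=> Aa b0; apply: (le_trans Aa); apply: (le_trans (leeDl _ b0)).
  by rewrite lee_pemull// adde_ge0// (le_trans _ Aa).
(* An infinite left limit makes the corresponding sublevel set the whole space, whose measure alone
   suffices because [2 ^+ N.-1 >= 1]. *)
have [Py|Py] := eqVneq (P f m) +oo%E.
  by apply: total => //; rewrite /D fcheck_lt_setT.
have [Qy|Qy] := eqVneq (P g (- m)) +oo%E.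
  by rewrite addeC; apply: total => //; rewrite /D fcheck_lt_setT.
have [p pE] : exists p, P f m = p%:E.
  by exists (fine (P f m)); rewrite fineK// ge0_fin_numE// ltey.
have [q qE] : exists q, P g (- m) = q%:E.
  by exists (fine (P g (- m))); rewrite fineK// ge0_fin_numE// ltey.
have p0 : 0 <= p by rewrite -lee_fin -pE.
have q0 : 0 <= q by rewrite -lee_fin -qE.
apply: (@le_trans _ _ (ballvol mu * (p + q) ^+ N)%:E); last first.
  apply: (@le_trans _ _ ((2 ^+ N.-1)%:E * ((ballvol mu * p ^+ N)%:E + (ballvol mu * q ^+ N)%:E))%E).
    rewrite -EFinD -EFinM lee_fin -mulrDr mulrCA ler_wpM2l ?ballvol_ge0//.
    by have := exprD_le_pow2 N.-1 p0 q0; rewrite prednK.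
  apply: lee_wpmul2l; first by rewrite lee_fin exprn_ge0.
  by apply: leeD; apply: measure_rho_minus_le.
apply: scale_expr_ge_right => r pqr.
(* Half of the slack [r - (p + q)] goes to each of the two enclosing balls. *)
pose e := (r - (p + q)) / 2.
have e0 : 0 < e by rewrite divr_gt0// subr_gt0.
have near_ball h k u : P h k = u%:E -> forall n, exists c,
    [set x | (h x < (eta n + k)%:E)%E] `<=` cball c (u + e).
  move=> uE n; apply: rho_minus_lt_cball; apply: (@le_lt_trans _ _ u%:E).
    by rewrite -uE; apply: ereal_sup_ubound; exists (eta n) => //=; exact: etaxi.
  by rewrite lte_fin ltrDl.
have /choice[c1 c1P] := near_ball _ _ _ pE.
have /choice[c2 c2P] := near_ball _ _ _ qE.
(* [r] exceeds [p + q] because the enclosing radius is an infimum that is not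
   shown to be attained; the balls obtained for different [n] are not nested. *)
pose c n := [tuple tnth (c1 n) i + tnth (c2 n) i | i < N].
have rE : r = p + e + (q + e) by rewrite /e; field.
apply: (@measure_eventually_le _ _ _ _ A (fun n => cball (c n) r)) => //.
- by move=> n; exact: measurable_cball.
- by move=> n; rewrite is_lebesgue_cball// (le_lt_trans _ pqr)// addr_ge0.
- move=> x /Axi /= /etaP[n xn]; exists n => k nk; rewrite rE.
  apply: (infconv_lt_cball hf hg hm) => /=; rewrite -?mE; [exact: c1P|exact: c2P|].
  by apply: (lt_le_trans xn); rewrite lee_fin eta_nd.
Qed.
End distribution.

(** * Young functions and the Luxemburg norm *)

Section einv.
Local Open Scope ereal_scope.
Variable R : realType.
Implicit Types x y z : \bar R.

Lemma einv_ge0 x : 0 <= x -> 0 <= einv x.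
Proof.
rewrite /einv; case: ifPn => // _; case: ifPn => // _ x0.
by rewrite lee_fin invr_ge0 fine_ge0.
Qed.

Lemma einv_antimono x y : 0 <= x -> x <= y -> einv y <= einv x.
Proof.
move=> x0 xy; rewrite {2}/einv; case: eqP => [_|/eqP xn0]; first exact: leey.
have {xn0}x_gt0 : 0 < x by rewrite lt0e xn0.
have [->|yNy] := eqVneq y +oo.
  rewrite /einv /=; case: ifPn => [|_]; first by rewrite lexx.
  by rewrite lee_fin invr_ge0 fine_ge0.
have : 0 < y by exact: lt_le_trans xy.
move: x_gt0 xy yNy; case: x x0 => [a| |] // _; case: y => [b| |] //.
rewrite /einv !lte_fin lee_fin => a0 ab _ b0 /=.
by rewrite eqe gt_eqF//= lee_fin lef_pV2.
Qed.

Lemma lt_einv (y : R) z : (0 < y)%R -> 0 <= z -> y%:E < einv z -> z < (y^-1)%:E.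
Proof.
move=> y0; case: z => [a| |] //.
  rewrite lee_fin /einv eqe /= => a0; case: eqP => [->|/eqP an0 /=].
    by rewrite lte_fin invr_gt0.
  have a_gt0 : (0 < a)%R by rewrite lt0r an0.
  by rewrite !lte_fin invf_pgt.
by rewrite /einv /= lte_fin => _ /(lt_trans y0); rewrite ltxx.
Qed.

Lemma einv_inv (y : R) : (0 < y)%R -> einv (y^-1)%:E = y%:E.
Proof. by move=> y0; rewrite /einv eqe invr_eq0 gt_eqF//= invrK. Qed.

End einv.

Section young.
Local Open Scope ereal_scope.
Variables (R : realType) (phi : \bar R -> \bar R).
Hypothesis phiY : young phi.

(** Convexity between [x] and 0, where [phi] vanishes. *)
Lemma young_scale_le (l : R) x : (0 <= l <= 1)%R -> 0 <= x -> phi (l%:E * x) <= l%:E * phi x.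
Proof.
have [phi0 [phi_ge0 [_ [_ [conv _]]]]] := phiY.
by move=> l01 x0; have := conv x 0 l x0 (lexx _) l01; rewrite phi0 !mule0 !adde0.
Qed.

(* By left continuity the superlevel sets of [phi] in [0, +oo] are half-open
   rays, and the decreasing map [einv] pulls them back to initial segments
   that do not contain their supremum. *)
Lemma young_einv_superlevel (r t : R) : (0 < r)%R -> (0 <= t)%R ->
  exists2 xi : \bar R, 0 <= xi &
    forall z, 0 <= z -> (t%:E < phi ((r^-1)%:E * `|einv z|)) = (z < xi).
Proof.
have [phi0 [phi_ge0 [_ [phi_homo [_ phi_lc]]]]] := phiY.
move=> r0 t0; pose J := [set z | 0 <= z /\ t%:E < phi ((r^-1)%:E * `|einv z|)].
have ri0 : 0 <= (r^-1)%:E by rewrite lee_fin invr_ge0 ltW.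
have einvE z : 0 <= z -> `|einv z| = einv z by move=> z0; rewrite gee0_abs// einv_ge0.
have down z z' : 0 <= z -> z <= z' -> J z' -> J z.
  move=> z0 zz' [z'0 tz']; split => //; apply: (lt_le_trans tz').
  rewrite !einvE//; apply: phi_homo; first by rewrite mule_ge0// einv_ge0.
  by rewrite lee_wpmul2l// einv_antimono.
have up z : J z -> exists2 z', J z' & z < z'.
  move=> [z0]; rewrite einvE//; set w := _ * _ => tw.
  have w_gt0 : 0 < w.
    rewrite lt0e mule_ge0// ?einv_ge0// andbT; apply: contraTneq tw => ->.
    by rewrite phi0 -leNgt lee_fin.
  move: tw; rewrite (phi_lc _ w_gt0) => /ereal_sup_gt[_ [y [y0 yw] <-] ty].
  have y_gt0 : 0 < y.
    by rewrite lt0e y0 andbT; apply: contraTneq ty => ->; rewrite phi0 -leNgt lee_fin.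
  have : y < +oo by rewrite (lt_le_trans yw)// leey.
  case: y y_gt0 y0 yw ty => [y| |] // y_gt0 _ yw ty _.
  have ry0 : (0 < r * y)%R by rewrite mulr_gt0.
  (* Left continuity gave [y < w] with [t < phi y]; this point is sent back to [y] by [einv]
     followed by division by [r]. *)
  exists ((r * y)^-1)%:E.
    split; first by rewrite lee_fin invr_ge0 ltW.
    rewrite einv_inv// gee0_abs; last by rewrite lee_fin ltW.
    by rewrite -EFinM mulKf// gt_eqF.
  apply: lt_einv => //; move: yw; rewrite /w EFinM.
  by rewrite -(@lte_pmul2l R r%:E)// muleA -!EFinM divff ?mul1e ?gt_eqF.
(* The maximum with 0 covers an empty [J], whose supremum is [-oo]. *)
exists (Order.max 0 (ereal_sup J)); first by rewrite le_max lexx.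
move=> z z0; rewrite lt_max ltNge z0/=; apply/idP/idP => [tz|/ereal_sup_gt[z' Jz' zz']].
  have [z' Jz' zz'] := up z (conj z0 tz).
  by apply: (lt_le_trans zz'); exact: ereal_sup_ubound.
by have [] := down z z' z0 (ltW zz') Jz'.
Qed.

End young.

(** Near-minimisers within [e / (2 * C)] of each infimum cost [e] in total. An infinite infimum, as
    for an empty set, makes the right side [+oo] since [C > 0]. *)
Lemma le_scale_ereal_infD (R : realType) (C : R) (S T : set R) (h : \bar R) : 0 < C ->
  (forall a, S a -> 0 <= a) -> (forall b, T b -> 0 <= b) ->
  (forall a b, S a -> T b -> (h <= (C * (a + b))%:E)%E) ->
  (h <= C%:E * (ereal_inf [set a%:E | a in S] + ereal_inf [set b%:E | b in T]))%E.
Proof.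
move=> C0 S0 T0 key.
have : (0 <= ereal_inf [set b%:E | b in T])%E.
  by apply: le_ereal_inf_tmp => _ [b /T0 b0 <-]; rewrite lee_fin.
have : (0 <= ereal_inf [set a%:E | a in S])%E.
  by apply: le_ereal_inf_tmp => _ [a /S0 a0 <-]; rewrite lee_fin.
case E : (ereal_inf [set a%:E | a in S]) => [x| |] // _; last first.
  by case: (ereal_inf _) => [y| |] // _; rewrite gt0_muley ?lte_fin// leey.
case F : (ereal_inf [set b%:E | b in T]) => [y| |] // _; last first.
  by rewrite gt0_muley ?lte_fin// leey.
apply/lee_addgt0Pr => e e0.
have d0 : 0 < e / (2 * C) by rewrite divr_gt0// mulr_gt0.
have [_ [a Sa <-]] : exists2 z, [set a%:E | a in S] z & (z < (x + e / (2 * C))%:E)%E.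
  by apply: ereal_inf_lt; rewrite E lte_fin ltrDl.
have [_ [b Tb <-]] : exists2 z, [set b%:E | b in T] z & (z < (y + e / (2 * C))%:E)%E.
  by apply: ereal_inf_lt; rewrite F lte_fin ltrDl.
rewrite !lte_fin => yb xa; apply: (le_trans (key a b Sa Tb)).
rewrite -EFinD lee_fin.
have -> : C * (x + y) + e = C * (x + e / (2 * C) + (y + e / (2 * C))).
  by field; rewrite gt_eqF.
by rewrite ler_pM2l// ltW// ltrD.
Qed.

(** * Modular and norm inequalities for the infimal convolution *)

Section luxemburg_infconv.
Variables (R : realType) (N : nat) (mu : {measure set (N.-tuple R) -> \bar R}).
Hypotheses (hN : (0 < N)%N) (hmu : is_lebesgue mu).
Variables (phi : \bar R -> \bar R).
Hypothesis phiY : young phi.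
Implicit Types (f g u : N.-tuple R -> \bar R).
Local Open Scope ereal_scope.

Definition modular (r : R) u := \int[mu]_(x in [set: N.-tuple R]) phi ((r^-1)%:E * `|einv (u x)|).

Lemma phi_arg_ge0 (r : R) (z : \bar R) : (0 < r)%R -> 0 <= phi ((r^-1)%:E * `|einv z|).
Proof.
have [_ [phi_ge0 _]] := phiY.
by move=> r0; rewrite phi_ge0// mule_ge0// lee_fin invr_ge0 ltW.
Qed.

(** Since [einv] reverses order and [phi] preserves it, the composite is radially nonincreasing,
    hence measurable. *)
Lemma measurable_phi_einv (r : R) u : (0 < r)%R -> (forall x, 0 <= u x) ->
  (forall x y, (enorm x <= enorm y)%R -> u x <= u y) ->
  measurable_fun setT (fun x => phi ((r^-1)%:E * `|einv (u x)|)).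
Proof.
have [_ [_ [_ [phi_homo _]]]] := phiY.
move=> r0 u0 u_homo; apply: measurable_fun_radial => x y yx; apply: phi_homo.
  by rewrite mule_ge0// lee_fin invr_ge0 ltW.
rewrite lee_wpmul2l ?lee_fin ?invr_ge0 ?(ltW r0)//.
by rewrite !gee0_abs ?einv_ge0// einv_antimono// u_homo.
Qed.

(** Since [1 / s = (r / s) * (1 / r)] with [r / s <= 1], convexity pulls the factor [r / s] out of
    [phi]. *)
Lemma modular_scale_le (r s : R) u : (0 < r)%R -> (r <= s)%R -> (forall x, 0 <= u x) ->
  (forall x y, (enorm x <= enorm y)%R -> u x <= u y) -> modular r u <= 1 ->
  modular s u <= (r / s)%:E.
Proof.
move=> r0 rs u0 u_homo mod1; have s0 : (0 < s)%R by exact: lt_le_trans rs.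
have l0 : (0 <= r / s)%R by rewrite divr_ge0// ltW.
have mu_ := measurable_phi_einv r0 u0 u_homo.
apply: (@le_trans _ _ ((r / s)%:E * modular r u)); last first.
  by rewrite -[leRHS]mule1 lee_wpmul2l// lee_fin.
rewrite /modular -ge0_integralZl//; last by move=> x _; exact: phi_arg_ge0.
apply: ge0_le_integral => //.
- by move=> x _; exact: phi_arg_ge0.
- exact: measurable_phi_einv.
- exact: measurable_funeM.
- move=> x _; have -> : (s^-1)%:E * `|einv (u x)| = (r / s)%:E * ((r^-1)%:E * `|einv (u x)|).
    by rewrite muleA -EFinM mulrAC divff ?mul1r// gt_eqF.
  apply: young_scale_le => //; first by rewrite l0 ler_pdivrMr// mul1r.
  by rewrite mule_ge0// lee_fin invr_ge0 ltW.
Qed.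

Lemma modular_infconv_le f g (m_f m_g m r : R) :
  ereal_inf (range f) = m_f%:E -> ereal_inf (range g) = m_g%:E -> (0 <= m_f + m_g)%R ->
  m = ((m_f - m_g) / 2)%R -> (0 < r)%R ->
  (forall x, 0 <= infconv f g x) ->
  (forall x, 0 <= fcheck f x - m%:E) -> (forall x, 0 <= fcheck g x + m%:E) ->
  modular r (infconv f g) <= (2 ^+ N.-1)%:E *
    (modular r (fun x => fcheck f x - m%:E) + modular r (fun x => fcheck g x + m%:E)).
Proof.
move=> hf hg hm mE r0 fg0 F0 G0.
rewrite /modular ge0_integralTE; last by move=> x; exact: phi_arg_ge0.
apply: ge_ereal_sup => _ [s /= s_le <-]; rewrite -integralT_nnsfun.
have ms : measurable_fun setT (fun x => (s x)%:E) by apply/measurable_EFinP.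
apply: le_integral_tails => //; first exact: is_lebesgue_sigma_finite.
- apply: measurable_phi_einv => // x y xy; by rewrite leeD2r// fcheck_homo.
- apply: measurable_phi_einv => // x y xy; by rewrite leeD2r// fcheck_homo.
- by move=> x; rewrite lee_fin.
- by move=> x; exact: phi_arg_ge0.
- by move=> x; exact: phi_arg_ge0.
(* A single level [xi] translates the height [t] for all three integrands into sublevel sets of the
   functions themselves. *)
move=> t t0; have [xi xi0 xiP] := young_einv_superlevel phiY r0 t0.
have -> : [set x | t%:E < phi ((r^-1)%:E * `|einv (fcheck f x - m%:E)|)] =
    [set x | fcheck f x - m%:E < xi] by apply/seteqP; split => x /=; rewrite xiP.
have -> : [set x | t%:E < phi ((r^-1)%:E * `|einv (fcheck g x + m%:E)|)] =
    [set x | fcheck g x + m%:E < xi] by apply/seteqP; split => x /=; rewrite xiP.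
apply: (measure_infconv_lt_le hN hmu hf hg hm) => //.
- exact: lt_le_trans xi0.
- rewrite -[X in measurable X]setTI; exact: emeasurable_fun_o_infty.
- by move=> x /= tx; rewrite -xiP//; apply: (lt_le_trans tx).
Qed.

Lemma luxemburg_infconv_le f g (m_f m_g m : R) :
  ereal_inf (range f) = m_f%:E -> ereal_inf (range g) = m_g%:E -> (0 <= m_f + m_g)%R ->
  m = ((m_f - m_g) / 2)%R ->
  (forall x, 0 <= infconv f g x) ->
  (forall x, 0 <= fcheck f x - m%:E) -> (forall x, 0 <= fcheck g x + m%:E) ->
  luxemburg mu phi (fun x => einv (infconv f g x)) <= (2 ^+ N.-1)%:E *
    (luxemburg mu phi (fun x => einv (fcheck f x - m%:E)) +
     luxemburg mu phi (fun x => einv (fcheck g x + m%:E))).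
Proof.
move=> hf hg hm mE fg0 F0 G0.
set F := fun x => fcheck f x - m%:E; set G := fun x => fcheck g x + m%:E.
pose C : R := (2 ^+ N.-1)%R; rewrite -/C.
have C1 : (1 <= C)%R by rewrite exprn_ege1// ler1n.
have C0 : (0 < C)%R by exact: lt_le_trans C1.
have F_homo x y : (enorm x <= enorm y)%R -> F x <= F y.
  by move=> xy; rewrite leeD2r// fcheck_homo.
have G_homo x y : (enorm x <= enorm y)%R -> G x <= G y.
  by move=> xy; rewrite leeD2r// fcheck_homo.
have key (a b : R) : (0 < a)%R -> (0 < b)%R -> modular a F <= 1 -> modular b G <= 1 ->
    luxemburg mu phi (fun x => einv (infconv f g x)) <= (C * (a + b))%:E.
  move=> a0 b0 Fa Gb; apply: ereal_inf_lbound; exists (C * (a + b))%R => //.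
  have ab0 : (0 < a + b)%R by rewrite addr_gt0.
  have r0 : (0 < C * (a + b))%R by rewrite mulr_gt0.
  split => //; apply: le_trans (modular_infconv_le hf hg hm mE r0 fg0 F0 G0) _.
  have ar : (a <= C * (a + b))%R.
    by rewrite (@le_trans _ _ (a + b)%R) ?lerDl ?(ltW b0)// ler_peMl// ltW.
  have br : (b <= C * (a + b))%R.
    by rewrite (@le_trans _ _ (a + b)%R) ?lerDr ?(ltW a0)// ler_peMl// ltW.
  (* At the scale [C * (a + b)] the two modulars are at most [a / (C * (a + b))] and
     [b / (C * (a + b))]; their sum is [1 / C], which absorbs the factor [C]. *)
  apply: (@le_trans _ _ (C%:E * ((a / (C * (a + b)))%:E + (b / (C * (a + b)))%:E))).
    rewrite lee_wpmul2l ?lee_fin ?(ltW C0)//.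
    by apply: leeD; exact: modular_scale_le.
  by rewrite -EFinD -EFinM lee_fin -mulrDl mulrA divff ?gt_eqF.
apply: le_scale_ereal_infD => //.
- by move=> a [/ltW].
- by move=> b [/ltW].
- by move=> a b [a0 Fa] [b0 Gb]; exact: key.
Qed.
End luxemburg_infconv.

Theorem theorem19 (R : realType) (N : nat) (hN : (0 < N)%N)
  (mu : {measure set (N.-tuple R) -> \bar R}) (hmu : is_lebesgue mu)
  (f g : N.-tuple R -> \bar R)
  (mf : measurable_fun [set: N.-tuple R] f) (mg : measurable_fun [set: N.-tuple R] g)
  (fNy : forall x, f x != -oo%E) (gNy : forall x, g x != -oo%E)
  (m_f m_g : R)
  (hmf : ereal_inf (range f) = m_f%:E) (hmg : ereal_inf (range g) = m_g%:E)
  (hm : 0 <= m_f + m_g) :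
  let m := (m_f - m_g) / 2 in
  [/\ (forall x, (0 <= infconv f g x)%E),
      (forall x, (0 <= fcheck f x - m%:E)%E),
      (forall x, (0 <= fcheck g x + m%:E)%E) &
      (forall phi : \bar R -> \bar R, young phi ->
         (luxemburg mu phi (fun x => einv (infconv f g x))
          <= (2 ^+ N.-1)%:E *
             (luxemburg mu phi (fun x => einv (fcheck f x - m%:E))
              + luxemburg mu phi (fun x => einv (fcheck g x + m%:E))))%E)].
Proof.
move=> m.
have fg0 x : (0 <= infconv f g x)%E.
  apply: le_ereal_inf_tmp => _ [y _ <-]; apply: (@le_trans _ _ (m_f%:E + m_g%:E)%E).
    by rewrite -EFinD lee_fin.
  rewrite -hmf -hmg; apply: leeD; apply: ereal_inf_lbound; first by exists (vsub x y).
  by exists y.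
have F0 x : (0 <= fcheck f x - m%:E)%E.
  rewrite sube_ge0//; apply: le_trans (fcheck_ge_inf f x).
  (* [m_f - m] equals [(m_f + m_g) / 2], and so does [m_g + m] below. *)
  by rewrite hmf lee_fin /m; lra.
have G0 x : (0 <= fcheck g x + m%:E)%E.
  rewrite -[m]opprK EFinN sube_ge0//; apply: le_trans (fcheck_ge_inf g x).
  by rewrite hmg lee_fin /m; lra.
split => // phi phiY; exact: (luxemburg_infconv_le hN hmu phiY hmf hmg hm).
Qed.
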